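(* Assume that $K$ is a monotone kernel function on $\mathbb{R}$, $R>0$, $n\in\mathbb{N}$, and $J\colon\mathbb{R}\to\mathbb{R}\cup\{-\infty\}$ is an $R$-admissible $n$-field function for $K$. Then there exists a number $q=q(K,J,R)$ such that for any positive $r_1,\ldots,r_n$ with $\sum_{j=1}^n r_j\le R$ and for all $\mathbf{y}\in\overline{S^{\infty}}$ we have $$\sup_{t\in\mathbb{R}}F(\mathbf{y},t)=\sup_{t\in[-q,q]}F(\mathbf{y},t),\qquad\text{where } F(\mathbf{y},t)=J(t)+\sum_{j=1}^n r_jK(t-y_j).$$
   Context: A kernel function (on $\mathbb{R}$) is a function $K\colon(-\infty,0)\cup(0,\infty)\to\mathbb{R}$ that is concave on $(-\infty,0)$ and concave on $(0,\infty)$ and satisfies $\lim_{t\downarrow0}K(t)=\lim_{t\uparrow0}K(t)$, this common limit being real or $-\infty$; one sets $K(0):=\lim_{t\to0}K(t)\in\mathbb{R}\cup\{-\infty\}$. $K$ is monotone if it is decreasing on $(-\infty,0)$ and increasing on $(0,\infty)$ (in the non-strict sense). An (external) $n$-field function on $\mathbb{R}$ is a function $J\colon\mathbb{R}\to\mathbb{R}\cup\{-\infty\}$ that is bounded above and takes finite values at more than $n$ different points. $J$ is $R$-admissible for $K$ if $\lim_{|t|\to\infty}(J(t)+RK(t))=-\infty$. $\overline{S^{\infty}}:=\{\mathbf{y}=(y_1,\ldots,y_n)\colon-\infty<y_1\le y_2\le\ldots\le y_n<\infty\}$. *)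

(* Defs.v *)
From HB Require Import structures.
From mathcomp Require Import all_boot all_order all_algebra.
From mathcomp Require Import all_classical all_reals all_analysis.

Set Implicit Arguments.
Unset Strict Implicit.
Unset Printing Implicit Defensive.

Import Order.TTheory GRing.Theory Num.Theory.
Import numFieldNormedType.Exports.

Local Open Scope classical_set_scope.
Local Open Scope ring_scope.

Definition concave_on (R : realType) (D : set R) (f : R -> R) : Prop :=
  convex_function (E := R^o) D (fun t => - f t).

(* A function on (-oo,0) `|` (0,+oo) is represented by a total K : R -> R whose
   value at 0 is junk: no definition below depends on K 0. *)
Definition kernel_function (R : realType) (K : R -> R) : Prop :=
  [/\ concave_on `]-oo, 0[ K,
      concave_on `]0, +oo[ K &
      exists2 l : \bar R, l != +oo%E &
        (K t)%:E @[t --> 0^'+] --> l /\ (K t)%:E @[t --> 0^'-] --> l].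

Definition monotone_kernel (R : realType) (K : R -> R) : Prop :=
  {in `]-oo, 0[ &, {homo K : s t / s <= t >-> t <= s}} /\
  {in `]0, +oo[ &, {homo K : s t / s <= t}}.

(* K extended by K(0) := lim_(t -> 0) K(t); 0^' is the punctured neighborhood
   filter. *)
Definition kernel_ext (R : realType) (K : R -> R) (t : R) : \bar R :=
  if t == 0 then lim ((K s)%:E @[s --> 0^']) else (K t)%:E.

(* Boundedness above by a real excludes the value +oo. *)
Definition field_function (R : realType) (n : nat) (J : R -> \bar R) : Prop :=
  (exists M : R, forall t, (J t <= M%:E)%E) /\
  (exists s : seq R,
     [/\ uniq s, (n < size s)%N & {in s, forall t, J t \is a fin_num}]).

Definition admissible (R : realType) (rho : R) (K : R -> R) (J : R -> \bar R) :
    Prop :=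
  (J t + rho%:E * kernel_ext K t)%E @[t --> +oo] --> -oo%E /\
  (J t + rho%:E * kernel_ext K t)%E @[t --> -oo] --> -oo%E.

(* The set \overline{S^oo} of nondecreasing node vectors. *)
Definition ordered_nodes (R : realType) (n : nat) : set ('I_n -> R) :=
  [set y | forall i j : 'I_n, (i <= j)%N -> y i <= y j].
Arguments ordered_nodes R n : clear implicits.

Definition sum_of_translates (R : realType) (n : nat) (K : R -> R)
    (J : R -> \bar R) (r y : 'I_n -> R) (t : R) : \bar R :=
  (J t + \sum_(j < n) (r j)%:E * kernel_ext K (t - y j))%E.

(* Main.v *)
(** Among the n + 1 points where J is finite, which are pairwise at least 2d
apart, some s is at distance at least d from every node y_j.  Concavity and
monotonicity of K then give
  K (t - y_j) - K (s - y_j) <= max (0, K t + C)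
for all large t, with C independent of y.  Hence F (y, t) - F (y, s) is at most
J t - J s + max (0, rho * (K t + C)), which is nonpositive for large t by
admissibility and because K is bounded below near infinity.  The case of large
-t follows by reflecting K and J. *)
Require Import Defs.
From mathcomp Require Import all_boot all_order all_algebra.
From mathcomp Require Import all_classical all_reals all_analysis.
From mathcomp Require Import ring lra.

Import Order.TTheory GRing.Theory Num.Theory.
Import numFieldNormedType.Exports.

Local Open Scope classical_set_scope.
Local Open Scope ring_scope.

(** * Increments of concave functions and the kernel at 0 *)

(** The points [b] and [a + h] are convex combinations of [b + h] and [a] with complementary
    weights, so the two concavity inequalities add up to the claim. *)
Lemma concave_on_increment (R : realType) (D : set R) (f : R -> R) (a b h : R) :
  concave_on D f -> D a -> D (b + h) -> a <= b -> 0 <= h ->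
  f (b + h) - f b <= f (a + h) - f a.
Proof.
move=> cf Da Db ab h0.
have [l0|l0] := leP (b + h - a) 0.
  have -> : b = a by lra.
  by have -> : h = 0 by lra.
have p0 : 0 <= (b - a) / (b + h - a) by apply: divr_ge0; lra.
have p1 : (b - a) / (b + h - a) <= 1 by rewrite ler_pdivrMr//; lra.
have q0 : 0 <= h / (b + h - a) by apply: divr_ge0; lra.
have q1 : h / (b + h - a) <= 1 by rewrite ler_pdivrMr//; lra.
pose p := Itv01 p0 p1.
pose q := Itv01 q0 q1.
have l_neq0 : b + h - a != 0 by rewrite gt_eqF.
have pE : conv p (b + h : convex_lmodType R^o) a = b.
  rewrite [LHS](_ : _ = (b - a) / (b + h - a) * (b + h) +
    (1 - (b - a) / (b + h - a)) * a) //; by field.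
have qE : conv q (b + h : convex_lmodType R^o) a = a + h.
  rewrite [LHS](_ : _ = h / (b + h - a) * (b + h) +
    (1 - h / (b + h - a)) * a) //; by field.
have := cf p (b + h) a; rewrite !inE => /(_ Db Da).
have := cf q (b + h) a; rewrite !inE => /(_ Db Da).
rewrite pE qE !convRE /= /unstable.onem.
have <- : 1 - (b - a) / (b + h - a) = h / (b + h - a) by field.
move: ((b - a) / _) => u.
nra.
Qed.

Lemma kernel_ext_neq0 (R : realType) (K : R -> R) (t : R) :
  t != 0 -> kernel_ext K t = (K t)%:E.
Proof. by rewrite /kernel_ext => /negbTE ->. Qed.

Lemma cvg_dnbhs_at_right_at_left (R : realType) (T : topologicalType)
    (f : R -> T) (p : R) (l : T) :
  f x @[x --> p^'+] --> l -> f x @[x --> p^'-] --> l ->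
  f x @[x --> p^'] --> l.
Proof.
move=> fr fl A lA.
have [a /= a0 fa] := fr _ lA; have [b /= b0 fb] := fl _ lA.
exists (Num.min a b) => /=; first by rewrite lt_min a0.
move=> x /=; rewrite lt_min => /andP[xa xb] xp.
by case: (ltgtP x p) xp => // [/(fb _ xb)|/(fa _ xa)].
Qed.

(** The value at 0 is the common one-sided limit, and monotonicity keeps the values between 0 and
    [t] at or below [K t]. This serves the case of a node equal to the evaluation point. *)
Lemma kernel_ext0_le (R : realType) (K : R -> R) (t : R) :
  kernel_function K -> monotone_kernel K -> t != 0 ->
  (kernel_ext K 0 <= (K t)%:E)%E.
Proof.
move=> [_ _ [l _ [lr ll]]] [Kdec Kinc] t0.
have -> : kernel_ext K 0 = l.
  rewrite /kernel_ext eqxx; apply/cvg_lim => //.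
  exact: cvg_dnbhs_at_right_at_left.
case: (ltgtP t 0) t0 => // t0 _.
- apply: (cvge_to_le ll); near=> u.
  have u0 : u < 0 by near: u; exact: nbhs_left_lt.
  rewrite lee_fin; apply: Kdec; rewrite ?in_itv//=.
  by near: u; exact: nbhs_left_ge.
- apply: (cvge_to_le lr); near=> u.
  have u0 : 0 < u by near: u; exact: nbhs_right_gt.
  rewrite lee_fin; apply: Kinc; rewrite ?in_itv//= ?u0 ?t0//.
  by near: u; exact: nbhs_right_le.
Unshelve. all: by end_near. Qed.

(** * Finite point sets: separation and pigeonhole *)

Lemma separated_seq (R : realType) (s : seq R) :
  exists2 d : R, 0 < d & {in s &, forall a b, a != b -> d <= `|a - b|}.
Proof.
elim: s => [|x s [d d0 IH]]; first by exists 1.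
(* The entry [x] may occur again in [s], so only entries different from [x] are kept away from
   it. *)
have [e e0 He] : exists2 e : R, 0 < e &
    {in s, forall a, a != x -> e <= `|a - x|}.
  elim: s {IH} => [|z s [e e0 IHs]]; first by exists 1.
  have [->|zx] := eqVneq z x.
    exists e => // a; rewrite inE => /orP[/eqP ->|/IHs//].
    by rewrite eqxx.
  exists (Num.min e `|z - x|).
    by rewrite lt_min e0 normr_gt0 subr_eq0.
  move=> a; rewrite inE ge_min => /orP[/eqP -> _|/IHs h /h ->//].
  by rewrite lexx orbT.
exists (Num.min d e); first by rewrite lt_min d0.
move=> a b; rewrite !inE !ge_min => /orP[/eqP ->|sa] /orP[/eqP ->|sb] ab.
- by rewrite eqxx in ab.
- by rewrite distrC He ?orbT// eq_sym.
- by rewrite He ?orbT.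
- by rewrite IH.
Qed.

(** Otherwise each point of [s] is within [d] of some node. Two points sharing a node would be less
    than [2d] apart, so choosing a node injects [s] into [n] indices. *)
Lemma pigeonhole_far (R : realType) (n : nat) (s : seq R) (d : R) :
  uniq s -> (n < size s)%N ->
  {in s &, forall a b, a != b -> d *+ 2 <= `|a - b|} ->
  forall y : 'I_n -> R, exists2 a, a \in s & forall j, d <= `|a - y j|.
Proof.
move=> us ns sep y; apply: contrapT => near.
have close a : a \in s -> exists j, `|a - y j| < d.
  move=> sa; apply: contrapT => far; apply: near; exists a => // j.
  by rewrite leNgt; apply/negP => ?; apply: far; exists j.
(* The choice function below is total on [R] and needs a default index; any point of [s] supplies
   one. *)
have [x0 sx0] : exists x, x \in s.
  by case: (s) ns => // x s' _; exists x; rewrite mem_head.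
have [j0 _] := close _ sx0.
have /choice[f fP] (a : R) : exists j, a \in s -> `|a - y j| < d.
  by have [/close[j ?]|] := boolP (a \in s); [exists j|exists j0].
have finj : {in s &, injective f}.
  move=> a b sa sb fab; apply/eqP; apply/negP => /negP /(sep _ _ sa sb).
  have := fP _ sa; have := fP _ sb; rewrite fab => h1 h2.
  have := ler_distD (y (f b)) a b; rewrite [X in _ <= _ + X]distrC mulr2n.
  by move: h1 h2; lra.
have /card_uniqP cardf : uniq (map f s) by rewrite map_inj_in_uniq.
have := max_card (mem (map f s)).
by rewrite cardf size_map card_ord leqNgt ns.
Qed.

(** * Growth of translates towards [+oo] *)

Section Growth.
(** [Ke] and the properties of [K] are abstract so that the section applies both to the kernel and
    to its reflection. *)
Variables (R : realType) (K : R -> R) (Ke : R -> \bar R).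
Hypothesis Kdec : {in `]-oo, 0[ &, {homo K : s t / s <= t >-> t <= s}}.
Hypothesis Kinc : {in `]0, +oo[ &, {homo K : s t / s <= t}}.
Hypothesis Kincrement : forall a b h, 0 < a -> a <= b -> 0 <= h ->
  K (b + h) - K b <= K (a + h) - K a.
Hypothesis KeE : forall x, x != 0 -> Ke x = (K x)%:E.
Hypothesis Ke0 : forall x, x != 0 -> (Ke 0 <= (K x)%:E)%E.

Lemma translate_growth (d A : R) : 0 < d -> exists C, forall s t y,
  `|s| <= A -> d <= `|s - y| -> 1 <= t -> A <= t ->
  (Ke (t - y) <= (K (s - y) + Num.max 0 (K t + C))%:E)%E.
Proof.
move=> d0.
have inc a b : 0 < a -> a <= b -> K a <= K b.
  by move=> a0 ab; apply: Kinc; rewrite ?in_itv //=; lra.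
have dec a b : b < 0 -> a <= b -> K b <= K a.
  by move=> a0 ab; apply: Kdec; rewrite ?in_itv //=; lra.
(* By concavity, a shift by [A + d] from any [t >= 1] gains at most the first difference. The
   minimum covers the reference values [K d] (node left of [s]) and [K (- d)] (node between [s] and
   [t]). *)
exists (K (1 + (A + d)) - K 1 - Num.min (K d) (K (- d))) => s t y sA sy t1 At.
have A0 : 0 <= A by apply: (le_trans _ sA); exact: normr_ge0.
have [sA1 sA2] : - A <= s /\ s <= A by move: sA; rewrite ler_norml => /andP.
have sy0 : s - y != 0 by rewrite -normr_gt0; lra.
have gt : K (t + (A + d)) - K t <= K (1 + (A + d)) - K 1.
  by apply: Kincrement => //; lra.
set m := Num.min _ _.
have m1 : m <= K d by rewrite ge_min lexx.
have m2 : m <= K (- d) by rewrite ge_min lexx orbT.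
set M := Num.max _ _.
have M1 : 0 <= M by rewrite le_max lexx.
have M2 : K t + (K (1 + (A + d)) - K 1 - m) <= M by rewrite le_max lexx orbT.
have [ty|ty|ty] := ltgtP t y.
- rewrite KeE ?lee_fin; last by rewrite lt_eqF//; lra.
  have : K (t - y) <= K (s - y) by apply: dec; lra.
  lra.
- rewrite KeE ?lee_fin; last by rewrite gt_eqF//; lra.
  have [ys|ys] := ltP y s.
    have sd : d <= s - y by move: sy; rewrite gtr0_norm; lra.
    (* Here [y] may be arbitrarily far to the left; comparing with the increment of the same length
       starting at [d] removes [y]. *)
    have := @Kincrement d (s - y) (t - s) d0 sd ltac:(lra).
    have -> : s - y + (t - s) = t - y by ring.
    have := @inc (d + (t - s)) (t + (A + d)) ltac:(lra) ltac:(lra).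
    lra.
  have sd : s - y <= - d by move: sy; rewrite ler0_norm; lra.
  have := @dec (s - y) (- d) ltac:(lra) sd.
  have := @inc (t - y) (t + (A + d)) ltac:(lra) ltac:(lra).
  lra.
- rewrite ty subrr; apply: (le_trans (Ke0 _ sy0)).
  by rewrite lee_fin; lra.
Qed.

Lemma far_translates_dominated (n : nat) (J : R -> \bar R) (rho m d A : R) :
  0 < d -> 0 < rho ->
  (J t + rho%:E * Ke t)%E @[t --> +oo] --> -oo%E ->
  exists T, forall t s (r y : 'I_n -> R), T < t ->
    `|s| <= A -> (forall j, d <= `|s - y j|) -> (m%:E <= J s)%E ->
    (forall j, 0 < r j) -> \sum_(j < n) r j <= rho ->
    (J t + \sum_(j < n) (r j)%:E * Ke (t - y j) <=
     J s + \sum_(j < n) (r j)%:E * Ke (s - y j))%E.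
Proof.
move=> d0 rho0 Jlim.
have [C HC] := @translate_growth d A d0.
(* The two bounds match the two values of the maximum: the first gives [J t + rho * (K t + C) <= m],
   the second, with [K 1 <= K t], gives [J t <= m]. *)
have [T1 [_ HT1]] := cvgeNy_le Jlim (m - rho * C).
have [T2 [_ HT2]] := cvgeNy_le Jlim (m + rho * K 1).
exists (Num.max (Num.max 1 A) (Num.max T1 T2)) => t s r y.
rewrite !gt_max => /andP[/andP[t1 At] /andP[/HT1 J1 /HT2 J2]] sA sy mJ r0 rle.
have t0 : t != 0 by rewrite gt_eqF//; lra.
have KtK1 : K 1 <= K t by apply: Kinc; rewrite ?in_itv/= ?andbT; lra.
move: J1 J2; rewrite KeE// -EFinM.
(* If [J t] is [-oo], the whole left side is [-oo]; the value [+oo] contradicts the bounds just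
   obtained. *)
case: (J t) => [jt| |]; first last.
- by move=> _ _; rewrite addNye leNye.
- by rewrite addye// leye_eq.
rewrite -EFinD !lee_fin => J1 J2.
set D := Num.max 0 (K t + C).
have D0 : 0 <= D by rewrite le_max lexx.
have DJ : jt + rho * D <= m.
  by rewrite /D; have [h|h] := leP 0 (K t + C); nra.
have -> : (\sum_(j < n) (r j)%:E * Ke (s - y j) =
    (\sum_(j < n) r j * K (s - y j))%:E)%E.
  rewrite -sumEFin; apply: eq_bigr => j _; rewrite KeE ?EFinM//.
  by rewrite -normr_gt0; exact: lt_le_trans (sy j).
have tle : (\sum_(j < n) (r j)%:E * Ke (t - y j) <=
    (\sum_(j < n) r j * (K (s - y j) + D))%:E)%E.
  rewrite -sumEFin; apply: lee_sum => j _.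
  rewrite EFinM lee_pmul2l// ?lte_fin//.
  by apply: HC => //; exact: ltW.
apply: (le_trans (leeD2l _ tle)).
apply: (le_trans _ (leeD2r _ mJ)).
rewrite -!EFinD lee_fin.
under eq_bigr do rewrite mulrDr.
rewrite big_split/= -mulr_suml.
have : (\sum_(j < n) r j) * D <= rho * D by rewrite ler_wpM2r.
lra.
Qed.

End Growth.

(** * Choice of the interval and comparison of the suprema *)

Theorem theorem3p1 (R : realType) (K : R -> R) (rho : R) (n : nat)
    (J : R -> \bar R)
    (hK : kernel_function K) (hKmono : monotone_kernel K)
    (hrho : 0 < rho) (hn : (0 < n)%N)
    (hJ : field_function n J) (hadm : admissible rho K J) :
  exists q : R, forall r : 'I_n -> R,
    (forall j, 0 < r j) -> \sum_(j < n) r j <= rho ->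
    forall y : 'I_n -> R, y \in ordered_nodes R n ->
      ereal_sup [set sum_of_translates K J r y t | t in [set: R]] =
      ereal_sup [set sum_of_translates K J r y t | t in `[- q, q]].
Proof.
have [_ [s [us ns finJ]]] := hJ.
have [e e0 sep] := separated_seq _ s.
have d0 : 0 < e / 2 by lra.
(* The point of [s] far from the nodes varies with [y]; bounds [A] and [m] valid on all of [s] keep
   [q] uniform. *)
have [A HA] : exists A, {in s, forall a, `|a| <= A}.
  elim: (s) => [|x s' [A HA]]; first by exists 0.
  exists (Num.max `|x| A) => a; rewrite inE le_max.
  by move=> /orP[/eqP ->|/HA ->]; rewrite ?lexx ?orbT.
have [m Hm] : exists m : R, {in s, forall a, (m%:E <= J a)%E}.
  elim: (s) finJ => [_|x s' IH finJ]; first by exists 0.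
  have [a ha|m Hm] := IH; first by apply: finJ; rewrite inE ha orbT.
  exists (Num.min (fine (J x)) m) => a; rewrite inE EFin_min ge_min.
  move=> /orP[/eqP ->|/Hm ->]; rewrite ?orbT// fineK ?lexx//.
  by apply: finJ; rewrite mem_head.
have [Kdec Kinc] := hKmono.
have [cneg cpos _] := hK.
have [admp admn] := hadm.
have [T1 HT1] : exists T, forall t s (r y : 'I_n -> R), T < t ->
    `|s| <= A -> (forall j, e / 2 <= `|s - y j|) -> (m%:E <= J s)%E ->
    (forall j, 0 < r j) -> \sum_(j < n) r j <= rho ->
    (sum_of_translates K J r y t <= sum_of_translates K J r y s)%E.
  apply: (@far_translates_dominated R K (kernel_ext K)) => //.
  - move=> a b h a0 ab h0; apply: (concave_on_increment _ _ _ _ _ _ cpos) => //;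
      rewrite /= in_itv/=; lra.
  - exact: kernel_ext_neq0.
  - by move=> x; exact: kernel_ext0_le.
have [T2 HT2] : exists T, forall (t s : R) (r y : 'I_n -> R), T < t ->
    `|s| <= A -> (forall j, e / 2 <= `|s - y j|) -> (m%:E <= J (- s)%R)%E ->
    (forall j, 0 < r j) -> \sum_(j < n) r j <= rho ->
    (J (- t)%R + \sum_(j < n) (r j)%:E * kernel_ext K (- (t - y j))%R <=
     J (- s)%R + \sum_(j < n) (r j)%:E * kernel_ext K (- (s - y j))%R)%E.
  apply: (@far_translates_dominated R (K \o -%R) (kernel_ext K \o -%R) _ _ _ _ _
    n (J \o -%R)) => //=.
  - by move=> a b; rewrite !in_itv/= ?andbT => a0 b0 ab; apply: Kinc;
      rewrite ?in_itv/= ?andbT; lra.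
  - by move=> a b; rewrite !in_itv/= ?andbT => a0 b0 ab; apply: Kdec;
      rewrite ?in_itv/= ?andbT; lra.
  (* Reflection reverses order and increments, so this is concavity of [K] on the negative half-line
     at [- (b + h) <= - (a + h)]. *)
  - move=> a b h a0 ab h0.
    have := @concave_on_increment _ _ _ (- (b + h)) (- (a + h)) h cneg.
    rewrite /= !in_itv/= => /(_ ltac:(lra) ltac:(lra) ltac:(lra) h0).
    rewrite !opprD !subrK; lra.
  - by move=> x x0; rewrite kernel_ext_neq0 ?oppr_eq0.
  - by move=> x x0; rewrite oppr0 kernel_ext0_le ?oppr_eq0.
  - apply/cvgeNyPle => M.
    have [T [_ HT]] := cvgeNy_le admn M.
    exists (- T); split => [|t tT]; first exact: num_real.
    by apply: HT; rewrite ltrNl.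
(* [T1] and [T2] control the two tails, while [A] puts the comparison point inside the interval. *)
exists (Num.max A (Num.max T1 T2)) => r r0 rle y _.
set q := Num.max _ _.
have qA : A <= q by rewrite le_max lexx.
have qT1 : T1 <= q by rewrite !le_max lexx orbT.
have qT2 : T2 <= q by rewrite !le_max lexx !orbT.
apply/eqP; rewrite eq_le; apply/andP; split; last first.
  by apply: ereal_sup_le => _ [t _ <-]; exists t.
have sep2 : {in s &, forall a b, a != b -> (e / 2) *+ 2 <= `|a - b|}.
  by move=> a b sa sb ab; have := sep a b sa sb ab; rewrite mulr2n; lra.
have [a sa afar] := pigeonhole_far _ _ _ _ us ns sep2 y.
have aA := HA _ sa.
have ma := Hm _ sa.
have domin t : q < `|t| ->
    (sum_of_translates K J r y t <= sum_of_translates K J r y a)%E.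
  have [t0|t0] := leP 0 t.
    by rewrite ger0_norm// => qt; apply: HT1 => //; lra.
  rewrite ltr0_norm// => qt.
  have := HT2 (- t) (- a) r (fun j => - y j).
  rewrite !opprK normrN.
  under [X in (_ + X <= _)%E]eq_bigr do rewrite -opprD opprK.
  under [X in (_ <= _ + X)%E]eq_bigr do rewrite -opprD opprK.
  apply => //; first lra.
  by move=> j; rewrite -opprD normrN.
apply: ge_ereal_sup => _ [t _ <-].
apply: le_ereal_sup_tmp.
have [qt|qt] := ltP q `|t|.
  exists (sum_of_translates K J r y a); last exact: domin.
  exists a => //; rewrite /= in_itv/= -ler_norml; exact: (le_trans aA).
exists (sum_of_translates K J r y t) => //.
by exists t => //; rewrite /= in_itv/= -ler_norml.
Qed.
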